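(* Let $f(x)\in\mathbb{Z}[x]$ be a polynomial of degree $n\ge 2$. If $f(x+s)$ is not an Eisenstein polynomial for every integer $s$ with $$0\le s\le n^{n/(n-1)}L(f)^2,$$ then $f$ is not a shifted Eisenstein polynomial.
   Context: A polynomial $g(x)=b_nx^n+\cdots+b_1x+b_0\in\mathbb{Z}[x]$ of degree $n$ is called Eisenstein (or irreducible by Eisenstein) if there is a prime $p$ such that (i) $p\mid b_i$ for $i=0,\ldots,n-1$, (ii) $p^2\nmid b_0$, (iii) $p\nmid b_n$. A polynomial $f\in\mathbb{Z}[x]$ is called a shifted Eisenstein polynomial if there exists an integer $s$ such that $f(x+s)$ is an Eisenstein polynomial. For $f(x)=a_nx^n+\cdots+a_1x+a_0$, the length is $L(f)=|a_0|+|a_1|+\cdots+|a_n|$. *)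

(* Defs.v *)
From mathcomp Require Import all_boot all_order all_algebra.

Set Implicit Arguments.
Unset Strict Implicit.
Unset Printing Implicit Defensive.

Import Order.TTheory GRing.Theory Num.Theory.
Local Open Scope ring_scope.

(* The degree of g <> 0 is (size g).-1, so condition (i) ranges over all
   coefficients except the leading one.  The zero polynomial is excluded by
   (iii), since its lead_coef is 0. *)
Definition eisenstein (g : {poly int}) : Prop :=
  exists p : nat,
    [/\ prime p,
        (forall i : nat, (i < (size g).-1)%N -> (p%:Z %| g`_i)%Z),
        ~~ (p%:Z ^+ 2 %| g`_0)%Z
      & ~~ (p%:Z %| lead_coef g)%Z].

Definition poly_shift (f : {poly int}) (s : int) : {poly int} :=
  f \Po ('X + s%:P).

Definition shifted_eisenstein (f : {poly int}) : Prop :=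
  exists s : int, eisenstein (poly_shift f s).

Definition poly_length (f : {poly int}) : int := \sum_(i < size f) `|f`_i|.

(* Main.v *)
(* If [f(x + s)] is Eisenstein at [p], then modulo [p] it is a constant times
   [x ^ n], and this forces [p ^ (n - 1)] to divide the discriminant of [f],
   which is nonzero since [f] is irreducible.  Bounding a determinant by the
   product of the l1-norms of its rows gives
   |disc f| <= n ^ n * L(f) ^ (2n - 2), hence p <= n ^ (n / (n - 1)) * L(f) ^ 2.
   Since [n >= 2], translating by a multiple of [p] preserves the Eisenstein
   property at [p], so [s] may be replaced by its residue modulo [p]. *)

Require Import Defs.
From mathcomp Require Import all_boot all_order all_algebra.
From mathcomp Require Import perm zify ring.
From mathcomp Require Import reals exp.

Import Order.TTheory GRing.Theory Num.Theory.
Local Open Scope ring_scope.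

(** * Determinants: row-sum bound, divisible columns, translation of rows *)

(** Expanding the product of row sums gives one nonnegative term for each map from rows to columns;
    the Leibniz formula involves only the terms of permutations. *)
Lemma normr_det_le_prod_sum (R : numDomainType) (N : nat) (A : 'M[R]_N) :
  `|\det A| <= \prod_i \sum_j `|A i j|.
Proof.
rewrite bigA_distr_bigA /determinant; apply: le_trans (ler_norm_sum _ _ _) _.
under eq_bigr do rewrite normrM normr_sign mul1r normr_prod.
rewrite [leLHS](_ : _ =
  \sum_(g in [set pval s | s : {perm 'I_N}]) \prod_i `|A i (g i)|); last first.
  rewrite big_imset /=; last by move=> s t _ _; apply: val_inj.
  by apply: eq_big => [s|s _]; rewrite ?inE ?pvalE.
rewrite big_mkcond /=; apply: ler_sum => g _; case: ifP => // _.
by rewrite prodr_ge0.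
Qed.

(** The factor [a] is pulled out of each of the first [k] columns by writing [A] as an integer
    matrix times a diagonal one. *)
Lemma dvdz_det_cols (a : int) (k l : nat) (A : 'M[int]_(k + l)) :
  (forall i (j : 'I_k), (a %| A i (lshift l j))%Z) -> (a ^+ k %| \det A)%Z.
Proof.
move=> dvd_a.
pose d : 'rV[int]_(k + l) := row_mx (const_mx a) (const_mx 1).
have -> : A = (\matrix_(i, j) (A i j %/ d 0%R j)%Z) *m diag_mx d.
  apply/matrixP => i j; rewrite mul_mx_diag !mxE; case: splitP => j' ej.
    rewrite mxE divzK //; have -> : j = lshift l j' by apply: val_inj.
    exact: dvd_a.
  by rewrite mxE divz1 mulr1.
rewrite det_mulmx det_diag dvdz_mull // big_split_ord /=.
under eq_bigr do rewrite row_mxEl mxE.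
by rewrite prodr_const card_ord dvdz_mulr.
Qed.

Definition coef_mx {R : nzSemiRingType} {N : nat} (r : 'I_N -> {poly R}) : 'M[R]_N :=
  \matrix_(i, j) (r i)`_j.

(** Translation multiplies the coefficient matrix on the right by [T], whose row [j] lists the
    coefficients of [('X + s%:P) ^+ j]; [T] is lower triangular with unit diagonal. The size bound
    ensures that no coefficient is cut off. *)
Lemma det_coef_mx_comp (R : comNzRingType) (N : nat) (r : 'I_N -> {poly R}) (s : R) :
  (forall i, (size (r i) <= N)%N) ->
  \det (coef_mx (fun i => r i \Po ('X + s%:P))) = \det (coef_mx r).
Proof.
move=> szr.
pose T : 'M[R]_N := \matrix_(j, l) (('X + s%:P) ^+ j)`_l.
have monT (j : nat) : ('X + s%:P) ^+ j \is monic.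
  by rewrite -[s]opprK polyCN monic_exp ?monicXsubC.
have szT (j : nat) : size (('X + s%:P) ^+ j) = j.+1.
  by rewrite -[s]opprK polyCN size_exp_XsubC.
have detT : \det T = 1.
  rewrite det_trig; last first.
    by apply/is_trig_mxP => i j ij; rewrite mxE nth_default ?szT.
  rewrite big1 // => i _; rewrite mxE.
  by have /monicP := monT i; rewrite /lead_coef szT.
rewrite -[RHS]mulr1 -detT -det_mulmx; congr (\det _).
apply/matrixP => i l; rewrite !mxE coef_comp_poly.
under [RHS]eq_bigr do rewrite !mxE.
rewrite (big_ord_widen _ (fun j => (r i)`_j * (('X + s%:P) ^+ j)`_l) (szr i)).
rewrite big_mkcond; apply: eq_bigr => j _; case: ltnP => // szj.
by rewrite nth_default ?mul0r.
Qed.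

(** * The discriminant matrix *)

(* Below, [n = m + 2]: the rows are the Sylvester rows of [f] and [f'], except
   that the shift of [f] of highest degree is replaced by [n f - X f'], which
   eliminates its leading coefficient; the determinant is then, up to sign, the
   discriminant of [f] rather than the resultant of [f] and [f']. *)
Definition disc_row {R : nzRingType} (m : nat) (f : {poly R})
    (i : 'I_(m.+1 + m.+1)) : {poly R} :=
  match split i with
  | inl i => f^`() * 'X^i
  | inr i => (if i == m :> nat then f *+ m.+2 - f^`() * 'X else f) * 'X^i
  end.

Lemma disc_row_lshift (R : nzRingType) (m : nat) (f : {poly R}) (i : 'I_m.+1) :
  disc_row m f (lshift m.+1 i) = f^`() * 'X^i.
Proof. by rewrite /disc_row (unsplitK (inl i)). Qed.

Lemma disc_row_rshift (R : nzRingType) (m : nat) (f : {poly R}) (i : 'I_m.+1) :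
  disc_row m f (rshift m.+1 i) =
  (if i == m :> nat then f *+ m.+2 - f^`() * 'X else f) * 'X^i.
Proof. by rewrite /disc_row (unsplitK (inr i)). Qed.

Lemma size_disc_row (R : nzRingType) (m : nat) (f : {poly R}) i :
  size f = m.+3 -> (size (disc_row m f i) <= m.+1 + m.+1)%N.
Proof.
move=> szf.
have szM (q : {poly R}) (j : nat) : (size q + j <= m.+1 + m.+1)%N ->
    (size (q * 'X^j)%R <= m.+1 + m.+1)%N.
  move=> le; apply: leq_trans (size_polyMleq _ _) _.
  by rewrite size_polyXn addnS.
rewrite -[i]splitK; case: (split i) => {}i; have := ltn_ord i => /=.
  rewrite disc_row_lshift => lti; apply: szM.
  have : (size f^`() < size f)%N by rewrite lt_size_deriv // -size_poly_eq0 szf.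
  by rewrite szf; lia.
rewrite disc_row_rshift => lti; apply: szM; case: eqP => [->|ne]; last first.
  by rewrite szf; lia.
(* The last row is shifted by [m], so it fits only because the terms of degree [m.+2] cancel. *)
suff : (size (f *+ m.+2 - f^`() * 'X)%R <= m.+2)%N by lia.
apply/leq_sizeP => -[|j] // lej; rewrite !coefE /=.
have [ltj|gej] := ltnP m.+1 j; last first.
  have -> : j = m.+1 by lia.
  by rewrite subrr.
by rewrite nth_default ?szf ?mul0rn ?subrr // ltnS.
Qed.

(** * Translations, and powers of [a] dividing the determinant *)

Lemma size_poly_shift (f : {poly int}) (s : int) : size (poly_shift f s) = size f.
Proof. by rewrite size_comp_poly2 // -[s]opprK polyCN size_XsubC. Qed.

Lemma poly_shiftD (f : {poly int}) (s t : int) :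
  poly_shift (poly_shift f s) t = poly_shift f (t + s).
Proof.
by rewrite /poly_shift -comp_polyA comp_polyD comp_polyX comp_polyC polyCD addrA.
Qed.

Lemma poly_shift0 (f : {poly int}) : poly_shift f 0 = f.
Proof. by rewrite /poly_shift addr0 comp_polyXr. Qed.

Lemma deriv_poly_shift (f : {poly int}) (s : int) :
  (poly_shift f s)^`() = poly_shift f^`() s.
Proof. by rewrite deriv_comp derivD derivX derivC addr0 mulr1. Qed.

Lemma coefM_low_dvdz (a : int) (k : nat) (p q : {poly int}) :
  (forall l, (l < k)%N -> (a %| p`_l)%Z) ->
  forall l, (l < k)%N -> (a %| (p * q)`_l)%Z.
Proof.
move=> dvdp l ltl; rewrite coefM; apply: rpred_sum => j _.
by rewrite dvdz_mulr // dvdp //; have := ltn_ord j; lia.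
Qed.

(** Modulo [a], the translate of [f] is a multiple of X^(m+2) and that of its derivative a multiple
    of X^(m+1), so every translated row is a multiple of X^(m+1). *)
Lemma disc_row_comp_low_dvdz (a : int) (m : nat) (f : {poly int}) (s : int) i :
  (forall l, (l < m.+2)%N -> (a %| (f \Po ('X + s%:P))`_l)%Z) ->
  forall l, (l < m.+1)%N -> (a %| (disc_row m f i \Po ('X + s%:P))`_l)%Z.
Proof.
move=> dvdh.
have dvdh1 l : (l < m.+1)%N -> (a %| (f \Po ('X + s%:P))`_l)%Z.
  by move=> ltl; apply: dvdh; lia.
have dvdh' l : (l < m.+1)%N -> (a %| (f^`() \Po ('X + s%:P))`_l)%Z.
  rewrite -/(poly_shift _ _) -deriv_poly_shift.
  by move=> ltl; rewrite coef_deriv rpredMn // dvdh.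
rewrite -[i]splitK; case: (split i) => {}i /=.
  by rewrite disc_row_lshift rmorphM /=; apply: coefM_low_dvdz.
rewrite disc_row_rshift rmorphM /=; apply: coefM_low_dvdz => l ltl.
case: eqP => _; last exact: dvdh1.
rewrite rmorphB rmorphMn rmorphM /= coefB coefMn.
by rewrite rpredB ?rpredMn ?dvdh1 // (coefM_low_dvdz _ m.+1).
Qed.

Lemma det_disc_row_dvdz (a : int) (m : nat) (f : {poly int}) (s : int) :
  size f = m.+3 ->
  (forall l, (l < m.+2)%N -> (a %| (f \Po ('X + s%:P))`_l)%Z) ->
  (a ^+ m.+1 %| \det (coef_mx (disc_row m f)))%Z.
Proof.
move=> szf dvdh; rewrite -(det_coef_mx_comp _ _ _ s); last first.
  by move=> i; apply: size_disc_row.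
by apply: dvdz_det_cols => i j; rewrite mxE (disc_row_comp_low_dvdz _ m) //= ltn_ord.
Qed.

(** * Nonvanishing of the determinant *)

Lemma det_disc_row_neq0 (m : nat) (f : {poly int}) :
  size f = m.+3 -> coprimep f f^`() -> \det (coef_mx (disc_row m f)) != 0.
Proof.
move=> szf cop; apply/det0P => -[v vn0 vM0].
pose x (i : nat) : int := v 0 (lshift m.+1 (inord i)).
pose y (i : nat) : int := v 0 (rshift m.+1 (inord i)).
(* The modified last row, weighted by [y m], puts [y m *+ m.+2] in degree [m] of [U] and [- y m] in
   degree [m.+1] of [V]. *)
pose U : {poly int} := \poly_(i < m.+1) (if i == m then y i *+ m.+2 else y i).
pose V : {poly int} := \poly_(i < m.+2) (if i == m.+1 then - y m else x i).
have eqUV : U * f + V * f^`() = 0.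
  have sum0 : \sum_i v 0 i *: disc_row m f i = 0.
    apply/polyP => j; rewrite coef0 coef_sum.
    have [ltj|gej] := ltnP j (m.+1 + m.+1).
      have /matrixP/(_ 0 (Ordinal ltj)) := vM0; rewrite !mxE => e; rewrite -[RHS]e.
      by apply: eq_bigr => i _; rewrite coefZ mxE.
    rewrite big1 // => i _; rewrite coefZ nth_default ?mulr0 //.
    by apply: leq_trans gej; apply: size_disc_row.
  have xE (i : 'I_m.+1) : x i = v 0 (lshift m.+1 i) by rewrite /x inord_val.
  have yE (i : 'I_m.+1) : y i = v 0 (rshift m.+1 i) by rewrite /y inord_val.
  have -> : V = \sum_(i < m.+1) x i *: 'X^i - y m *: 'X^(m.+1).
    rewrite /V poly_def big_ord_recr /= eqxx scaleNr; congr (_ - _).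
    by apply: eq_bigr => i _; rewrite ltn_eqF.
  have -> : U = \sum_(i < m) y i *: 'X^i + (y m *+ m.+2) *: 'X^m.
    rewrite /U poly_def big_ord_recr /= eqxx; congr (_ + _).
    by apply: eq_bigr => i _; rewrite ltn_eqF.
  rewrite -[RHS]sum0 big_split_ord /= [X in _ = _ + X]big_ord_recr /=.
  under [in RHS]eq_bigr do rewrite disc_row_lshift -xE scalerAr mulrC.
  under [in X in _ = _ + X]eq_bigr => i _.
    rewrite disc_row_rshift -yE /= ltn_eqF // scalerAr mulrC.
  over.
  rewrite /= -!mulr_suml disc_row_rshift -yE /= eqxx.
  move: (\sum_(i < m.+1) _) (\sum_(i < m) _) => B A.
  rewrite -!mul_polyC exprS polyCMn.
  ring.
have V0 : V = 0.
  apply/eqP; apply/negPn/negP => Vn0.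
  have : f %| V.
    have VE : V * f^`() = - (U * f) by apply/eqP; rewrite -addr_eq0 addrC eqUV.
    by rewrite -(Gauss_dvdpl _ cop) VE dvdpNr dvdp_mull.
  move=> /(dvdp_leq Vn0); rewrite szf => /leq_trans/(_ (size_poly _ _)).
  by rewrite ltnn.
have U0 : U = 0.
  move/eqP: eqUV; rewrite V0 mul0r addr0 mulf_eq0 => /orP[/eqP//|].
  by rewrite -size_poly_eq0 szf.
have ym0 : y m = 0.
  have := congr1 (fun q : {poly int} => q`_m.+1) V0.
  by rewrite coef_poly ltnSn eqxx coef0 => /eqP; rewrite oppr_eq0 => /eqP.
have x0 i : (i < m.+1)%N -> x i = 0.
  move=> lti; have := congr1 (fun q : {poly int} => q`_i) V0.
  by rewrite coef_poly coef0 ltnS ltnW // ltn_eqF.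
have y0 i : (i < m.+1)%N -> y i = 0.
  move=> lti; have := congr1 (fun q : {poly int} => q`_i) U0.
  by rewrite coef_poly coef0 lti; case: eqP => [->|].
case/eqP: vn0; apply/rowP => i; rewrite mxE -[i]splitK.
by case: (split i) => {}i /=; [rewrite -(x0 i)|rewrite -(y0 i)] => //;
   rewrite /x /y inord_val.
Qed.

(** * Eisenstein polynomials under translation, and coprimality with the derivative *)

(** Second-order Taylor expansion with remainder over [R] itself, by induction on the Horner form;
    it gives control modulo the square of [c]. *)
Lemma comp_XaddC_expansion (R : comNzRingType) (c : R) (g : {poly R}) :
  exists q, g \Po ('X + c%:P) = g + c *: g^`() + c ^+ 2 *: q.
Proof.
elim/poly_ind: g => [|g a [q eq_g]].
  by exists 0; rewrite comp_poly0 deriv0 !scaler0 !addr0.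
exists (g^`() + q * ('X + c%:P)).
rewrite comp_poly_MXaddC eq_g derivD derivM derivX derivC -!mul_polyC rmorphXn /=.
by ring.
Qed.

(** The prime is made explicit so that it can stay fixed while the shift varies. *)
Definition eisenstein_at (p : nat) (g : {poly int}) : Prop :=
  [/\ prime p,
      (forall i : nat, (i < (size g).-1)%N -> (p%:Z %| g`_i)%Z),
      ~~ (p%:Z ^+ 2 %| g`_0)%Z
    & ~~ (p%:Z %| lead_coef g)%Z].

(** Lower coefficients change by multiples of [p], and the constant one by [p%:Z * t * g]_1[plus a
    multiple of p^2. As the degree is at least 2,]p[divides]g[_1], so the constant coefficient is
    unchanged modulo p^2. *)
Lemma eisenstein_at_shift (p : nat) (g : {poly int}) (t : int) :
  (2 < size g)%N -> eisenstein_at p g ->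
  eisenstein_at p (poly_shift g (p%:Z * t)).
Proof.
move=> szg [p_pr dvd_low ndvd0 ndvd_lead].
have [q eq_q] := comp_XaddC_expansion _ (p%:Z * t) g.
have coef_shift i : (poly_shift g (p%:Z * t))`_i =
    g`_i + p%:Z * t * (g`_i.+1 *+ i.+1) + (p%:Z * t) ^+ 2 * q`_i.
  by rewrite /poly_shift eq_q !coefD !coefZ coef_deriv.
split=> //.
- move=> i; rewrite size_poly_shift => lti; rewrite coef_shift expr2 -!mulrA.
  by rewrite !rpredD ?dvd_low // dvdz_mulr.
- have dvd1 : (p%:Z %| g`_1)%Z by apply: dvd_low; lia.
  rewrite coef_shift mulr1n exprMn -addrA -!mulrA rpredDr //.
  apply: rpredD; last by rewrite mulrA -expr2; apply: dvdz_mulr.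
  by rewrite expr2; apply: dvdz_mul => //; apply: dvdz_mull.
- rewrite lead_coef_comp; last by rewrite -[_ * t]opprK polyCN size_XsubC.
  by rewrite -[_ * t]opprK polyCN lead_coefXsubC expr1n mulr1.
Qed.

(** The translate is irreducible by Eisenstein's criterion and cannot divide its derivative, which
    is nonzero of smaller degree; translating back by [- s] preserves coprimality. *)
Lemma eisenstein_at_coprimep_deriv (p : nat) (f : {poly int}) (s : int) :
  (1 < size f)%N -> eisenstein_at p (poly_shift f s) -> coprimep f f^`().
Proof.
move=> szf [p_pr dvd_low ndvd0 ndvd_lead].
set h := poly_shift f s in dvd_low ndvd0 ndvd_lead.
have szh : size h = size f by exact: size_poly_shift.
have szh1 : size h != 1%N by lia.
have irr_h := eisenstein_crit p_pr szh1 ndvd_lead ndvd0 dvd_low.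
have cop_h : coprimep h h^`().
  rewrite irreducible_poly_coprime //; apply/negP => /dvdp_leq.
  have hn0 : h != 0 by rewrite -size_poly_eq0; lia.
  have h'n0 : h^`() != 0.
    apply/negP => /eqP h'0; have : h^`()`_(size h).-2 = 0 by rewrite h'0 coef0.
    rewrite coef_deriv; have -> : (size h).-2.+1 = (size h).-1 by lia.
    by move/eqP; rewrite mulrn_eq0 lead_coef_eq0 (negbTE hn0) orbF; lia.
  by move=> /(_ h'n0); rewrite leqNgt lt_size_deriv.
have := coprimep_comp_poly ('X + (- s)%:P) cop_h.
by rewrite -!/(poly_shift _ _) deriv_poly_shift !poly_shiftD addNr !poly_shift0.
Qed.

(** * Size of the rows and of the determinant *)

Lemma sum_norm_coef_MXn_le (q : {poly int}) (B : int) (k N : nat) :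
  (forall N, \sum_(j < N) `|q`_j| <= B) -> \sum_(j < N) `|(q * 'X^k)`_j| <= B.
Proof.
move=> leB; elim: k N => [|k IHk] N; first by rewrite mulr1.
case: N => [|N]; first by have := leB 0%N; rewrite !big_ord0.
rewrite big_ord_recl exprSr mulrA !coefMX normr0 add0r.
by under eq_bigr do rewrite coefMX.
Qed.

Lemma sum_norm_coef_le (q f : {poly int}) (c : nat) (N : nat) :
  (forall j, `|q`_j| <= c%:Z * `|f`_j|) ->
  \sum_(j < N) `|q`_j| <= c%:Z * poly_length f.
Proof.
move=> le_qf; rewrite /poly_length mulr_sumr.
apply: (@le_trans _ _ (\sum_(j < N) c%:Z * `|f`_j|)).
  by apply: ler_sum => j _; apply: le_qf.
have [leN|ltN] := leqP N (size f).
  rewrite (big_ord_widen _ (fun j => c%:Z * `|f`_j|) leN) big_mkcond /=.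
  by apply: ler_sum => j _; case: ifP; rewrite ?mulr_ge0.
rewrite [leRHS](big_ord_widen _ (fun j => c%:Z * `|f`_j|) (ltnW ltN)).
rewrite [leRHS]big_mkcond /=; apply: ler_sum => j _; case: ltnP => // gej.
by rewrite nth_default ?normr0 ?mulr0.
Qed.

Lemma sum_norm_coef_deriv_le (f : {poly int}) (n N : nat) :
  (size f <= n.+1)%N -> \sum_(j < N) `|f^`()`_j| <= n%:Z * poly_length f.
Proof.
move=> szf.
(* Multiplying by ['X] aligns the indices: the coefficient of degree j becomes j times that of
   [f]. *)
have -> : \sum_(j < N) `|f^`()`_j| = \sum_(j < N.+1) `|(f^`() * 'X)`_j|.
  rewrite big_ord_recl coefMX normr0 add0r.
  by apply: eq_bigr => j _; rewrite coefMX.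
apply: sum_norm_coef_le => -[|j]; rewrite coefMX ?normr0 ?mulr_ge0 //= coef_deriv.
have [lej|gtj] := leqP j.+1 n; last first.
  by rewrite nth_default ?mul0rn ?normr0 ?mulr0 // (leq_trans szf).
by rewrite normrMn -mulr_natl natz ler_wpM2r // lez_nat.
Qed.

(** The coefficient of degree j is (n - j) times that of [f], so the modified row costs no more than
    a derivative row. *)
Lemma sum_norm_coef_disc_last_le (f : {poly int}) (n N : nat) :
  (size f <= n.+1)%N ->
  \sum_(j < N) `|(f *+ n - f^`() * 'X)`_j| <= n%:Z * poly_length f.
Proof.
move=> szf; apply: sum_norm_coef_le => j; rewrite coefB coefMn coefMX.
have -> : (if j == 0 then 0 else f^`()`_j.-1) = f`_j *+ j.
  by case: j => [|j] //=; rewrite coef_deriv.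
have [lej|gtj] := leqP j n; last first.
  by rewrite nth_default ?mul0rn ?subrr ?normr0 ?mulr0 // (leq_trans szf).
by rewrite -mulrnBr // normrMn -mulr_natl natz ler_wpM2r // lez_nat leq_subr.
Qed.

(** The [m.+1] derivative rows and the modified row contribute [m.+2%:Z * L] each, the other [m]
    rows contribute [L] each. *)
Lemma det_disc_row_le (m : nat) (f : {poly int}) : size f = m.+3 ->
  `|\det (coef_mx (disc_row m f))| <= m.+2%:Z ^+ m.+2 * poly_length f ^+ (m.+1).*2.
Proof.
move=> szf; apply: le_trans (normr_det_le_prod_sum _ _ _) _.
set L := poly_length f.
have L0 : 0 <= L by apply: sumr_ge0.
have leL N : \sum_(j < N) `|f`_j| <= L.
  by rewrite -[L]mul1r; apply: sum_norm_coef_le => j; rewrite mul1r.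
have le1 (i : 'I_m.+1) :
    \sum_j `|coef_mx (disc_row m f) (lshift m.+1 i) j| <= m.+2%:Z * L.
  under eq_bigr do rewrite mxE disc_row_lshift.
  by apply: sum_norm_coef_MXn_le => N; apply: sum_norm_coef_deriv_le; rewrite szf.
have le2 (i : 'I_m.+1) :
    \sum_j `|coef_mx (disc_row m f) (rshift m.+1 i) j| <=
    (if i == m :> nat then m.+2%:Z else 1) * L.
  under eq_bigr do rewrite mxE disc_row_rshift.
  apply: sum_norm_coef_MXn_le => N; case: eqP => _; last by rewrite mul1r.
  by apply: sum_norm_coef_disc_last_le; rewrite szf.
rewrite big_split_ord /=; apply: (@le_trans _ _
  ((\prod_(i < m.+1) (m.+2%:Z * L)) *
   \prod_(i < m.+1) ((if i == m :> nat then m.+2%:Z else 1) * L))).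
  by apply: ler_pM; rewrite ?prodr_ge0 => // *; rewrite ?sumr_ge0 //;
     apply: ler_prod => i _; rewrite ?le1 ?le2 sumr_ge0.
rewrite prodr_const card_ord big_split /= prodr_const card_ord.
rewrite big_ord_recr /= eqxx big1 => [|i _]; last by rewrite ltn_eqF.
rewrite mul1r exprMn -addnn exprD [m.+2%:Z ^+ m.+2]exprSr le_eqVlt.
by apply/orP; left; apply/eqP; ring.
Qed.

(** * Bound on the prime, and reduction of the shift modulo it *)

Lemma eisenstein_at_prime_le (p m : nat) (f : {poly int}) (s : int) :
  size f = m.+3 -> eisenstein_at p (poly_shift f s) ->
  p%:Z ^+ m.+1 <= m.+2%:Z ^+ m.+2 * poly_length f ^+ (m.+1).*2.
Proof.
move=> szf eis; apply: le_trans (det_disc_row_le _ _ szf).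
have cop : coprimep f f^`() by apply: eisenstein_at_coprimep_deriv eis; rewrite szf.
have := det_disc_row_neq0 _ _ szf cop.
have : (p%:Z ^+ m.+1 %| \det (coef_mx (disc_row m f)))%Z.
  case: eis => _ dvd_low _ _; apply: (det_disc_row_dvdz _ _ _ s) => // l ltl.
  by apply: dvd_low; rewrite size_poly_shift szf.
rewrite dvdzE -absz_gt0 => dvd gt0; have := dvdn_leq gt0 dvd.
by rewrite -lez_nat !abszE ger0_norm // exprn_ge0.
Qed.

Theorem theorem3 (R : realType) (n : nat) (f : {poly int})
    (hn : (2 <= n)%N) (hdeg : size f = n.+1)
    (hf : forall s : int, 0 <= s ->
       s%:~R <= (n%:R : R) `^ (n%:R / (n%:R - 1)) * (poly_length f)%:~R ^+ 2 ->
       ~ eisenstein (poly_shift f s)) :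
  ~ shifted_eisenstein f.
Proof.
case: n hn hdeg hf => [|[|m]] // _ szf hf [s [p eis]].
have p_pr : prime p by case: eis.
have p0 : p%:Z != 0 by have := prime_gt0 p_pr; lia.
(* The residue of [s] is below [p], so it suffices to bound [p]. *)
apply: (hf (s %% p%:Z)%Z); first exact: modz_ge0.
  apply: (@le_trans _ _ p%:R).
    rewrite -[p%:R]/((p%:Z)%:~R) ler_int ltW // ltz_pmod //.
    by have := prime_gt0 p_pr; lia.
  have m1 : (m.+2%:R - 1 : R) = m.+1%:R by rewrite -natr1 addrK.
  have L0 : 0 <= (poly_length f)%:~R :> R by rewrite ler0z sumr_ge0.
  (* Raising both sides to the power [m.+1], which is n - 1, clears the denominator of the real
     exponent. *)
  rewrite -(@ler_pXn2r _ m.+1) ?nnegrE ?mulr_ge0 ?powR_ge0 ?exprn_ge0 ?ler0n //.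
  rewrite exprMn -[X in X * _]powR_mulrn ?powR_ge0 // -powRrM m1 divfK ?pnatr_eq0 //.
  rewrite powR_mulrn // -exprM mul2n.
  have := eisenstein_at_prime_le _ _ _ _ szf eis.
  by rewrite -(ler_int R) rmorphM !rmorphXn.
(* The residue differs from [s] by a multiple of [p], so the Eisenstein property at [p] carries
   over. *)
exists p; have -> : (s %% p%:Z)%Z = p%:Z * - (s %/ p%:Z)%Z + s.
  by rewrite {3}(divz_eq s p%:Z); ring.
rewrite -poly_shiftD; apply: eisenstein_at_shift eis.
by rewrite size_poly_shift szf.
Qed.
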